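(* Let $G_2$ be a sentence of PA (which exists by the diagonal theorem) such that $$\mathrm{PA}\vdash G_2\leftrightarrow\forall\{\mathbf{x}_{w1}\}\bigl(d_{FC}(\overline{\#G_2},\{\mathbf{x}_{w1}\})\rightarrow\neg\exists(\mathbf{x}_1,\{\mathbf{x}_w\})\,d_{PE}(\overline{\#G_2},\mathbf{x}_1,\{\mathbf{x}_w\})\bigr).$$ If PA is consistent, then $G_2$ is not provable in PA; if PA is $\omega$-consistent, then $\neg G_2$ is not provable in PA.
   Context: PA is first-order Peano Arithmetic in the language with $0$, successor $'$, $+$, $\times$, $=$. A standard effective Gödel coding of formulas and proofs of PA by natural numbers is fixed; $\#F$ denotes the Gödel code of $F$. $\mathbb{N}=\{0,1,2,\dots\}$; solutions of Diophantine equations are always sought in $\mathbb{N}$. For $n\in\mathbb{N}$, $\overline{n}$ is the numeral $0''\cdots{}'$ ($n$ successors). $\{x_w\}$, $\{x_{w1}\}$ abbreviate finite tuples of variables (different tuples consist of different variables), and $\forall\{\dots\}$, $\exists(\dots)$ blocks of quantifiers; boldface variables are formal variables of PA. Representational formula: given a polynomial $D$ with integer coefficients, rewrite $D=0$ as $D_L=D_R$, where $D_L,D_R$ are polynomials with natural-number coefficients; replace each variable or parameter by a formal variable of PA, each power by a repeated product, and each natural-number constant by its numeral. The resulting formula $d_L=d_R$ of PA is the representational formula of $D=0$. By the MRDP theorem one fixes the following polynomials with integer coefficients. $D_{PE}(y,x_0,\{x_w\})$: for every formula $F$ of PA and every $a\in\mathbb{N}$, $a$ is the Gödel code of a proof of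 $F$ in PA iff $D_{PE}(\#F,a,\{x_w\})=0$ has a solution $\{x_w\}$ in $\mathbb{N}$. $D_{FC}(a,\{x_{w1}\})$: for all $a\in\mathbb{N}$, the equation $D_{FC}(a,\{x_{w1}\})=0$ has a solution $\{x_{w1}\}$ in $\mathbb{N}$ iff $a$ is the Gödel code of a formula of PA. $d_{PE}$ and $d_{FC}$ are their representational formulas. PA is $\omega$-consistent if there is no formula $A(\mathbf{x})$ with one free variable such that $\mathrm{PA}\vdash A(\overline{n})$ for every $n\in\mathbb{N}$ and $\mathrm{PA}\vdash\neg\forall\mathbf{x}\,A(\mathbf{x})$. *)

(* Defs.v *)
(* MathComp world. *)
From HB Require Import structures.
From mathcomp Require Import all_boot all_order all_algebra.
From mathcomp.multinomials Require Import mpoly.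

Set Implicit Arguments.
Unset Strict Implicit.
Unset Printing Implicit Defensive.

Import GRing.Theory.

(* Formal variables are named by natural numbers: [Var x] is the x-th one. *)
Inductive term : Type :=
| Var of nat
| Zero
| Succ of term
| Add of term & term
| Mul of term & term.

Inductive formula : Type :=
| Eq of term & term
| Neg of formula
| And of formula & formula
| Or of formula & formula
| Imp of formula & formula
| All of nat & formula
| Ex of nat & formula.

Definition Iff (A B : formula) : formula := And (Imp A B) (Imp B A).

Definition alls (xs : seq nat) (A : formula) : formula := foldr All A xs.
Definition exs (xs : seq nat) (A : formula) : formula := foldr Ex A xs.

Definition numeral (n : nat) : term := iter n Succ Zero.

(* [CodeSeq.code] is MathComp's computable bijection [seq nat -> nat]. *)
Fixpoint term_code (t : term) : nat :=
  match t with
  | Var x => CodeSeq.code [:: 0; x]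
  | Zero => CodeSeq.code [:: 1]
  | Succ t => CodeSeq.code [:: 2; term_code t]
  | Add t u => CodeSeq.code [:: 3; term_code t; term_code u]
  | Mul t u => CodeSeq.code [:: 4; term_code t; term_code u]
  end.

Fixpoint code (A : formula) : nat :=
  match A with
  | Eq t u => CodeSeq.code [:: 0; term_code t; term_code u]
  | Neg A => CodeSeq.code [:: 1; code A]
  | And A B => CodeSeq.code [:: 2; code A; code B]
  | Or A B => CodeSeq.code [:: 3; code A; code B]
  | Imp A B => CodeSeq.code [:: 4; code A; code B]
  | All x A => CodeSeq.code [:: 5; x; code A]
  | Ex x A => CodeSeq.code [:: 6; x; code A]
  end.

Definition proof_code (s : seq formula) : nat := CodeSeq.code (map code s).

Lemma term_code_inj : injective term_code.
Proof.
have ci := can_inj CodeSeq.codeK.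
elim=> [x||t IHt|t IHt u IHu|t IHt u IHu] [y||t'|t' u'|t' u'] /ci // [].
- by move->.
- by move/IHt->.
- by move=> /IHt-> /IHu->.
- by move=> /IHt-> /IHu->.
Qed.

Lemma code_inj : injective code.
Proof.
have ci := can_inj CodeSeq.codeK.
elim=> [t u|A IHA|A IHA B IHB|A IHA B IHB|A IHA B IHB|x A IHA|x A IHA]
  [t' u'|A'|A' B'|A' B'|A' B'|x' A'|x' A'] /ci // [].
- by move=> /term_code_inj-> /term_code_inj->.
- by move/IHA->.
- by move=> /IHA-> /IHB->.
- by move=> /IHA-> /IHB->.
- by move=> /IHA-> /IHB->.
- by move=> -> /IHA->.
- by move=> -> /IHA->.
Qed.

Lemma proof_code_inj : injective proof_code.
Proof. by move=> s s' /(can_inj CodeSeq.codeK) /(inj_map code_inj). Qed.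

HB.instance Definition _ := Equality.copy formula (inj_type code_inj).

Fixpoint tfree (x : nat) (t : term) : bool :=
  match t with
  | Var y => x == y
  | Zero => false
  | Succ t => tfree x t
  | Add t u | Mul t u => tfree x t || tfree x u
  end.

Fixpoint free (x : nat) (A : formula) : bool :=
  match A with
  | Eq t u => tfree x t || tfree x u
  | Neg A => free x A
  | And A B | Or A B | Imp A B => free x A || free x B
  | All y A | Ex y A => (x != y) && free x A
  end.

Definition sentence (A : formula) : Prop := forall x, ~~ free x A.

Fixpoint tsubst (x : nat) (t : term) (u : term) : term :=
  match u with
  | Var y => if x == y then t else u
  | Zero => Zero
  | Succ u => Succ (tsubst x t u)
  | Add u v => Add (tsubst x t u) (tsubst x t v)
  | Mul u v => Mul (tsubst x t u) (tsubst x t v)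
  end.

(* Substitution of [t] for the free occurrences of [x], without renaming of
   bound variables: it is meaningful only when [freefor x t A] holds. *)
Fixpoint subst (x : nat) (t : term) (A : formula) : formula :=
  match A with
  | Eq u v => Eq (tsubst x t u) (tsubst x t v)
  | Neg A => Neg (subst x t A)
  | And A B => And (subst x t A) (subst x t B)
  | Or A B => Or (subst x t A) (subst x t B)
  | Imp A B => Imp (subst x t A) (subst x t B)
  | All y A => if x == y then All y A else All y (subst x t A)
  | Ex y A => if x == y then Ex y A else Ex y (subst x t A)
  end.

(* [t] is free for [x] in [A]: no variable of [t] is captured by [subst]. *)
Fixpoint freefor (x : nat) (t : term) (A : formula) : bool :=
  match A with
  | Eq _ _ => true
  | Neg A => freefor x t A
  | And A B | Or A B | Imp A B => freefor x t A && freefor x t B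
  | All y B | Ex y B => ~~ free x A || (~~ tfree y t && freefor x t B)
  end.

(* Kleene's Hilbert-style system for classical first-order arithmetic
   (Introduction to Metamathematics, section 19).  The equality and
   arithmetic axioms are single formulas in the variables 0, 1, 2, their other
   instances being derivable by generalization; [Var x] is always free for
   [x] under [subst x (Succ (Var x))], so induction needs no side condition. *)
Inductive axiom : formula -> Prop :=
| ax_K A B : axiom (Imp A (Imp B A))
| ax_S A B C :
    axiom (Imp (Imp A B) (Imp (Imp A (Imp B C)) (Imp A C)))
| ax_andI A B : axiom (Imp A (Imp B (And A B)))
| ax_andl A B : axiom (Imp (And A B) A)
| ax_andr A B : axiom (Imp (And A B) B)
| ax_orl A B : axiom (Imp A (Or A B))
| ax_orr A B : axiom (Imp B (Or A B))
| ax_orE A B C : axiom (Imp (Imp A C) (Imp (Imp B C) (Imp (Or A B) C)))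
| ax_negI A B : axiom (Imp (Imp A B) (Imp (Imp A (Neg B)) (Neg A)))
| ax_negE A : axiom (Imp (Neg (Neg A)) A)
| ax_all x t A : freefor x t A -> axiom (Imp (All x A) (subst x t A))
| ax_ex x t A : freefor x t A -> axiom (Imp (subst x t A) (Ex x A))
| ax_ind x A :
    axiom (Imp (And (subst x Zero A)
                    (All x (Imp A (subst x (Succ (Var x)) A))))
               A)
| ax_succ_inj :
    axiom (Imp (Eq (Succ (Var 0)) (Succ (Var 1))) (Eq (Var 0) (Var 1)))
| ax_succ_neq0 : axiom (Neg (Eq (Succ (Var 0)) Zero))
| ax_eq_trans :
    axiom (Imp (Eq (Var 0) (Var 1))
               (Imp (Eq (Var 0) (Var 2)) (Eq (Var 1) (Var 2))))
| ax_eq_succ :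
    axiom (Imp (Eq (Var 0) (Var 1)) (Eq (Succ (Var 0)) (Succ (Var 1))))
| ax_add0 : axiom (Eq (Add (Var 0) Zero) (Var 0))
| ax_addS :
    axiom (Eq (Add (Var 0) (Succ (Var 1))) (Succ (Add (Var 0) (Var 1))))
| ax_mul0 : axiom (Eq (Mul (Var 0) Zero) Zero)
| ax_mulS :
    axiom (Eq (Mul (Var 0) (Succ (Var 1)))
              (Add (Mul (Var 0) (Var 1)) (Var 0))).

Inductive immediate_consequence (s : seq formula) : formula -> Prop :=
| rule_mp A B : A \in s -> Imp A B \in s -> immediate_consequence s B
| rule_all x A C : ~~ free x C -> Imp C A \in s ->
    immediate_consequence s (Imp C (All x A))
| rule_ex x A C : ~~ free x C -> Imp A C \in s ->
    immediate_consequence s (Imp (Ex x A) C).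

Definition derivation (s : seq formula) : Prop :=
  forall s1 A s2, s = s1 ++ A :: s2 -> axiom A \/ immediate_consequence s1 A.

Definition is_proof (s : seq formula) (A : formula) : Prop :=
  derivation s /\ exists s1, s = rcons s1 A.

Definition provable (A : formula) : Prop := exists s, is_proof s A.

Definition is_proof_code (a : nat) (A : formula) : Prop :=
  exists s, proof_code s = a /\ is_proof s A.

Definition is_formula_code (a : nat) : Prop := exists A, code A = a.

Definition consistent : Prop := ~ exists A, provable A /\ provable (Neg A).

Definition omega_consistent : Prop :=
  ~ exists (x : nat) (A : formula),
      [/\ forall y, free y A = (y == x),
          forall n, provable (subst x (numeral n) A)
        & provable (Neg (All x A))].

Definition is_root n (D : {mpoly int[n]}) (v : n.-tuple nat) : Prop :=
  (D.@[fun i => (tnth v i)%:Z] = 0)%R.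

(* Written-out polynomials in n variables with natural-number coefficients. *)
Inductive natpoly (n : nat) : Type :=
| PVar of 'I_n
| PConst of nat
| PAdd of natpoly n & natpoly n
| PMul of natpoly n & natpoly n
| PPow of natpoly n & nat.

Fixpoint mpoly_of n (P : natpoly n) : {mpoly int[n]} :=
  match P with
  | PVar i => 'X_i
  | PConst c => c%:R
  | PAdd P Q => mpoly_of P + mpoly_of Q
  | PMul P Q => mpoly_of P * mpoly_of Q
  | PPow P e => mpoly_of P ^+ e
  end%R.

(* [iterop] yields t * (t * ... * t) with e factors, and 1 when e = 0. *)
Fixpoint term_of n (xs : n.-tuple nat) (P : natpoly n) : term :=
  match P with
  | PVar i => Var (tnth xs i)
  | PConst c => numeral c
  | PAdd P Q => Add (term_of xs P) (term_of xs Q)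
  | PMul P Q => Mul (term_of xs P) (term_of xs Q)
  | PPow P e => iterop e Mul (term_of xs P) (numeral 1)
  end.

(* [d] is a representational formula of D = 0, the variables of D becoming the
   distinct formal variables xs.  The rewriting of D = 0 as D_L = D_R, and the
   way D_L and D_R are written out, are left arbitrary. *)
Definition representational n (D : {mpoly int[n]}) (xs : n.-tuple nat)
    (d : formula) : Prop :=
  uniq xs /\
  exists DL DR : natpoly n,
    D = (mpoly_of DL - mpoly_of DR)%R /\
    d = Eq (term_of xs DL) (term_of xs DR).

(* Main.v *)
(* If PA proves G2, a code of that proof and of G2 itself yield numerical
   solutions of the two Diophantine equations; since PA verifies true numerical
   equations, it proves the existential closures of both representational
   formulas, against the equivalence for G2.  If PA proves ~G2, the equivalence
   gives PA |- exists x d(x) for the proof equation, which has no solution by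
   the first part.  Omega-consistency concerns a single variable, so it is
   applied to A(b) := forall x (x_1 + ... + x_n = b -> ~ d(x)): for each numeral
   b there are finitely many x to inspect, and PA refutes every false
   numerical equation, so PA |- A(b) for all b, whereas PA |- ~ forall b A(b). *)
Require Import Defs.
From mathcomp Require Import all_boot all_order all_algebra.
From mathcomp.multinomials Require Import mpoly.

Set Implicit Arguments.
Unset Strict Implicit.
Unset Printing Implicit Defensive.

Import GRing.Theory.

(* [vector.free] shadows the predicate of [Defs]. *)
Local Notation free := Defs.free.

(** * Derivations from hypotheses *)

Lemma immediate_consequence_mono (s s' : seq formula) A :
  {subset s <= s'} -> immediate_consequence s A -> immediate_consequence s' A.
Proof.
move=> ss' [B C /ss' Bs /ss' BCs|x B C xC /ss' Cs|x B C xC /ss' Cs].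
- exact: rule_mp BCs.
- exact: rule_all.
- exact: rule_ex.
Qed.

Lemma derivation_rcons s A :
  derivation (rcons s A) <->
  derivation s /\ (axiom A \/ immediate_consequence s A).
Proof.
split=> [ds|[ds dA] s1 B s2].
  split; last by apply: (ds s A [::]); rewrite -cats1.
  move=> s1 B s2 es; apply: (ds s1 B (rcons s2 A)).
  by rewrite es rcons_cat.
case/lastP: s2 => [|s2 C]; first by rewrite cats1 => /rcons_inj[<- <-].
by rewrite -rcons_cons -rcons_cat => /rcons_inj[/ds].
Qed.

Lemma derivation_cat s1 s2 :
  derivation s1 -> derivation s2 -> derivation (s1 ++ s2).
Proof.
move=> d1; elim/last_ind: s2 => [|s2 A IH]; first by rewrite cats0.
case/derivation_rcons => d2 dA; rewrite -rcons_cat; apply/derivation_rcons.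
split; first exact: IH.
case: dA => [|dA]; [by left|right].
by apply: immediate_consequence_mono dA => B; rewrite mem_cat => ->; apply: orbT.
Qed.

Lemma provable_axiom A : axiom A -> provable A.
Proof.
move=> axA; exists [:: A]; split; last by exists [::].
by apply/(derivation_rcons [::] A); split; [case|left].
Qed.

Lemma provable_mp A B : provable (Imp A B) -> provable A -> provable B.
Proof.
move=> [t [dAB [s1 et]]] [u [dA [s2 eu]]]; rewrite et in dAB; rewrite eu in dA.
exists (rcons (rcons s1 (Imp A B) ++ rcons s2 A) B); split; last by eexists.
apply/derivation_rcons; split; first exact: derivation_cat.
by right; apply: (@rule_mp _ A); rewrite mem_cat !mem_rcons !inE eqxx ?orbT.
Qed.

Lemma provable_all_imp x A C :
  ~~ free x C -> provable (Imp C A) -> provable (Imp C (All x A)).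
Proof.
move=> xC [t [d [s et]]]; rewrite et in d; exists (rcons (rcons s (Imp C A)) (Imp C (All x A))).
split; last by eexists.
apply/derivation_rcons; split=> //; right; apply: rule_all => //.
by rewrite mem_rcons inE eqxx.
Qed.

Lemma provable_ex_imp x A C :
  ~~ free x C -> provable (Imp A C) -> provable (Imp (Ex x A) C).
Proof.
move=> xC [t [d [s et]]]; rewrite et in d; exists (rcons (rcons s (Imp A C)) (Imp (Ex x A) C)).
split; last by eexists.
apply/derivation_rcons; split=> //; right; apply: rule_ex => //.
by rewrite mem_rcons inE eqxx.
Qed.

(** The head of [G] becomes the innermost antecedent, so [ent (A :: G) B] and [ent G (Imp A B)] are
    convertible: the deduction theorem holds by computation. *)
Definition imps (G : seq formula) (A : formula) : formula :=
  foldl (fun B C => Imp C B) A G.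

Definition ent (G : seq formula) (A : formula) : Prop := provable (imps G A).

Lemma ent_provable G A : provable A -> ent G A.
Proof.
elim: G A => [//|B G IH] A pA; apply: IH.
exact: provable_mp (provable_axiom (ax_K A B)) pA.
Qed.

Lemma ent_axiom G A : axiom A -> ent G A.
Proof. by move=> /provable_axiom; apply: ent_provable. Qed.

Lemma ent_mp A G B : ent G (Imp A B) -> ent G A -> ent G B.
Proof.
elim: G A B => [|C G IH] A B; first exact: provable_mp.
move=> eAB eA; apply: (IH (Imp C (Imp A B))) => //.
by apply: (IH (Imp C A)) => //; apply: ent_axiom; constructor.
Qed.

Lemma provable_imp_refl A : provable (Imp A A).
Proof.
apply: (provable_mp _ (provable_axiom (ax_K A (Imp A A)))).
apply: (provable_mp _ (provable_axiom (ax_K A A))).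
exact: provable_axiom (ax_S _ _ _).
Qed.

Lemma ent_hyp G A : A \in G -> ent G A.
Proof.
elim: G => [//|B G IH]; rewrite inE => /orP[/eqP<-|/IH eA].
  exact: (ent_provable G (provable_imp_refl A)).
by apply: (@ent_mp A G (Imp B A)) => //; apply: ent_axiom (ax_K A B).
Qed.

(** Weakening, exchange and contraction at once: the hypotheses in [G] are turned into antecedents
    and detached one by one in [H]. *)
Lemma ent_sub G H A : {subset G <= H} -> ent G A -> ent H A.
Proof.
elim: G A => [|B G IH] A sGH; first exact: ent_provable.
move=> eA; apply: (@ent_mp B H A); last by apply/ent_hyp/sGH; rewrite inE eqxx.
by apply: IH eA => C CG; apply: sGH; rewrite inE CG orbT.
Qed.

Lemma ent_cut A G B : ent G A -> ent (A :: G) B -> ent G B.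
Proof. by move=> eA eB; apply: (@ent_mp A G B). Qed.

Lemma ent_wk G A B : ent G B -> ent (A :: G) B.
Proof. by apply: ent_sub => C; rewrite inE orbC => ->. Qed.

Lemma ent_head G A : ent (A :: G) A.
Proof. exact: (ent_provable G (provable_imp_refl A)). Qed.

(* Going through [\in] instead would make [done] evaluate the codes by which
   equality of formulas is decided. *)
Ltac hyp := solve [repeat first [exact: ent_head | apply: ent_wk]].

Lemma ent_negI A B G : ent (A :: G) B -> ent (A :: G) (Neg B) -> ent G (Neg A).
Proof.
move=> e1 e2; apply: (@ent_mp (Imp A (Neg B))) => //.
by apply: (@ent_mp (Imp A B)) => //; apply: ent_axiom (ax_negI _ _).
Qed.

Lemma ent_negE A G : ent G (Neg (Neg A)) -> ent G A.
Proof. by apply: ent_mp; apply: ent_axiom (ax_negE _). Qed.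

Lemma ent_absurd B G A : ent G B -> ent G (Neg B) -> ent G A.
Proof.
by move=> e1 e2; apply: ent_negE; apply: (@ent_negI _ B); apply: ent_wk.
Qed.

Lemma ent_orE A B G C :
  ent G (Or A B) -> ent (A :: G) C -> ent (B :: G) C -> ent G C.
Proof.
move=> eAB eA eB; apply: ent_mp eAB; apply: (@ent_mp (Imp B C)) => //.
by apply: (@ent_mp (Imp A C)) => //; apply: ent_axiom (ax_orE _ _ _).
Qed.

Lemma free_imps x G A :
  free x (imps G A) = has (free x) G || free x A.
Proof.
rewrite /imps; elim: G A => [//|B G IH] A /=.
by rewrite IH /= orbA orbAC -orbA [X in _ || X]orbC orbCA orbA.
Qed.

(** [rule_ex] acts on the outermost antecedent, whereas the head of a context is the innermost one;
    so [A] is moved to the end of the list and the quantified formula is moved back. *)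
Lemma ent_exE x A G C :
  ~~ has (free x) G -> ~~ free x C -> ent (A :: G) C -> ent (Ex x A :: G) C.
Proof.
move=> xG xC eC; have/provable_ex_imp: provable (Imp A (imps G C)).
  have: ent (G ++ [:: A]) C.
    by apply: ent_sub eC => B; rewrite mem_cat !inE orbC.
  by rewrite /ent /imps foldl_cat.
move=> /(_ x); rewrite free_imps negb_or xG xC => /(_ isT) eE.
have: ent (G ++ [:: Ex x A]) C by rewrite /ent /imps foldl_cat.
by apply: ent_sub => B; rewrite mem_cat !inE orbC.
Qed.

(** * Substitution *)

Lemma tfree_numeral x n : tfree x (numeral n) = false.
Proof. by elim: n. Qed.

Lemma tsubst_id x t u : ~~ tfree x u -> tsubst x t u = u.
Proof.
elim: u => [y|//|u IH|u IHu v IHv|u IHu v IHv] /=.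
- by move/negPf->.
- by move/IH->.
- by rewrite negb_or => /andP[/IHu-> /IHv->].
- by rewrite negb_or => /andP[/IHu-> /IHv->].
Qed.

Lemma tsubst_var x u : tsubst x (Var x) u = u.
Proof.
by elim: u => [y||u /= ->|u /= -> v ->|u /= -> v ->] //=; case: eqP => // ->.
Qed.

Lemma subst_var x A : subst x (Var x) A = A.
Proof.
elim: A => [t u|A /= ->|A /= -> B ->|A /= -> B ->|A /= -> B ->|y A /= ->|y A /= ->] //=.
- by rewrite !tsubst_var.
- by case: eqP.
- by case: eqP.
Qed.

Lemma freefor_var x A : freefor x (Var x) A.
Proof.
elim: A => //= [A -> B ->|A -> B ->|A -> B ->|y A ->|y A ->] //.
1-2: by rewrite (eq_sym y); case: (x == y); rewrite ?orbT.
Qed.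

Lemma provable_all x A : provable A -> provable (All x A).
Proof.
(* The generalization rule acts on the consequent of an implication, so a closed theorem serves as
   dummy antecedent. *)
pose T := Imp (Eq Zero Zero) (Eq Zero Zero).
move=> pA; apply: (@provable_mp T); last exact: provable_imp_refl.
by apply: provable_all_imp => //; apply: (ent_provable [:: T]).
Qed.

Lemma provable_subst x t A :
  freefor x t A -> provable A -> provable (subst x t A).
Proof.
by move=> fA /(provable_all x); apply: provable_mp; apply: provable_axiom (ax_all fA).
Qed.

Lemma ent_all_var x G A : ent G (All x A) -> ent G A.
Proof.
apply: ent_mp; rewrite -{2}(subst_var x A).
exact: ent_axiom (ax_all (freefor_var x A)).
Qed.

Lemma ent_ex_var x G A : ent G A -> ent G (Ex x A).
Proof.
apply: ent_mp; rewrite -{1}(subst_var x A).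
exact: ent_axiom (ax_ex (freefor_var x A)).
Qed.

(** The step gets generalized over [x], hence is proved from [A] alone; any side hypothesis has to
    be an antecedent within the induction formula. *)
Lemma provable_ind x A :
  provable (subst x Zero A) -> ent [:: A] (subst x (Succ (Var x)) A) ->
  provable A.
Proof.
move=> p0 pS; apply: provable_mp (provable_axiom (ax_ind x A)) _.
apply: (@ent_mp _ [::]); last exact: provable_all pS.
apply: (@ent_mp _ [::]) p0; exact: ent_axiom (ax_andI _ _).
Qed.

Fixpoint qf (A : formula) : bool :=
  match A with
  | Eq _ _ => true
  | Neg A => qf A
  | And A B | Or A B | Imp A B => qf A && qf B
  | All _ _ | Ex _ _ => false
  end.

Lemma qf_freefor x t A : qf A -> freefor x t A.
Proof. by elim: A => //= A IHA B IHB /andP[/IHA-> /IHB->]. Qed.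

Lemma qf_subst x t A : qf A -> qf (subst x t A).
Proof. by elim: A => //= A IHA B IHB /andP[/IHA-> /IHB->]. Qed.

Fixpoint tinst (s : seq term) (t : term) : term :=
  match t with
  | Var x => nth (Var x) s x
  | Zero => Zero
  | Succ t => Succ (tinst s t)
  | Add t u => Add (tinst s t) (tinst s u)
  | Mul t u => Mul (tinst s t) (tinst s u)
  end.

(* Simultaneous substitution, meaningful on quantifier-free formulas only. *)
Fixpoint inst (s : seq term) (A : formula) : formula :=
  match A with
  | Eq t u => Eq (tinst s t) (tinst s u)
  | Neg A => Neg (inst s A)
  | And A B => And (inst s A) (inst s B)
  | Or A B => Or (inst s A) (inst s B)
  | Imp A B => Imp (inst s A) (inst s B)
  | All x A => All x A
  | Ex x A => Ex x A
  end.

Lemma tinst_numeral s n : tinst s (numeral n) = numeral n.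
Proof. by elim: n => //= n ->. Qed.

Fixpoint tbound (t : term) : nat :=
  match t with
  | Var x => x.+1
  | Zero => 0
  | Succ t => tbound t
  | Add t u | Mul t u => maxn (tbound t) (tbound u)
  end.

Lemma tbound_tfree x t : tbound t <= x -> ~~ tfree x t.
Proof.
elim: t => [y|//|//|t IHt u IHu|t IHt u IHu] /=; first by move/gtn_eqF->.
1-2: by rewrite geq_max negb_or => /andP[/IHt-> /IHu->].
Qed.

Fixpoint fbound (A : formula) : nat :=
  match A with
  | Eq t u => maxn (tbound t) (tbound u)
  | Neg A => fbound A
  | And A B | Or A B | Imp A B => maxn (fbound A) (fbound B)
  | All x A | Ex x A => fbound A
  end.

Lemma fbound_free x A : fbound A <= x -> ~~ free x A.
Proof.
elim: A => [t u|A|A IHA B IHB|A IHA B IHB|A IHA B IHB|y A IH|y A IH] //=.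
- by rewrite geq_max negb_or => /andP[/tbound_tfree-> /tbound_tfree->].
1-3: by rewrite geq_max negb_or => /andP[/IHA-> /IHB->].
1-2: by move/IH=> /negPf->; rewrite andbF.
Qed.

(* The variables 0, 1, 2 are first renamed to fresh ones: the terms [t0], [t1]
   and [t2] may themselves contain them. *)
Lemma provable_inst t0 t1 t2 A :
  qf A -> fbound A <= 3 -> provable A -> provable (inst [:: t0; t1; t2] A).
Proof.
pose s := [:: t0; t1; t2] => qA bA pA.
have [m [m3 m0 m1 m2]] :
    exists m, [/\ 3 <= m, tbound t0 <= m, tbound t1 <= m & tbound t2 <= m].
  exists (maxn 3 (maxn (tbound t0) (maxn (tbound t1) (tbound t2)))).
  by rewrite !leq_max !leqnn !orbT.
pose ts := [:: (0, Var m); (1, Var m.+1); (2, Var m.+2);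
              (m, t0); (m.+1, t1); (m.+2, t2)].
have pts : provable (foldl (fun B p => subst p.1 p.2 B) A ts).
  elim: ts A qA pA {bA} => [//|[x t] ts IH] A qA pA /=.
  by apply: IH; [exact: qf_subst|apply: provable_subst pA; exact: qf_freefor].
(* Since [m] lies above the variables of [t0], [t1] and [t2], later substitutions leave an inserted
   term alone, and the six in a row act like the simultaneous one. *)
have tE t : tbound t <= 3 ->
    foldl (fun u p => tsubst p.1 p.2 u) t ts = tinst s t.
  have fE x u : tbound u <= m -> m <= x -> forall v, tsubst x v u = u.
    by move=> um mx v; rewrite tsubst_id // tbound_tfree // (leq_trans um).
  rewrite /ts /=.
  elim: t => [x|//|t IH|t IHt u IHu|t IHt u IHu] /=; last 3 first.
  - by move/IH->.
  - by rewrite geq_max => /andP[/IHt-> /IHu->].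
  - by rewrite geq_max => /andP[/IHt-> /IHu->].
  have [n1 n2] : 1 == m = false /\ 2 == m = false.
    by split; apply: ltn_eqF; apply: leq_trans m3.
  have [k0 k1 k2] : [/\ m == m.+1 = false, m == m.+2 = false & m.+1 == m.+2 = false].
    by split; apply: ltn_eqF.
  have j1 : 2 == m.+1 = false by apply: ltn_eqF; rewrite ltnS (leq_trans _ m3).
  case: x => [|[|[|//]]] _ /=.
  - by rewrite n1 /= n2 /= eqxx !fE // leqW.
  - by rewrite j1 /= k0 /= eqxx fE // leqW.
  - by rewrite k1 /= k2 /= eqxx.
suff <- : foldl (fun B p => subst p.1 p.2 B) A ts = inst s A by [].
elim: A qA bA {pts pA} =>
  [t u|A IH|A IHA B IHB|A IHA B IHB|A IHA B IHB|//|//] /=.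
- by rewrite geq_max => _ /andP[/tE <- /tE <-].
- by move=> q b; rewrite -IH.
1-3: by move=> /andP[q1 q2]; rewrite geq_max => /andP[b1 b2]; rewrite -IHA -?IHB.
Qed.

(** * Arithmetic in PA *)

Section Equality.
Variable G : seq formula.

Lemma ent_euclid t u v : ent G (Eq t u) -> ent G (Eq t v) -> ent G (Eq u v).
Proof.
move=> tu; apply: ent_mp; apply: ent_mp tu; apply: ent_provable.
exact: (provable_inst t u v _ _ (provable_axiom ax_eq_trans)).
Qed.

Lemma ent_add0 t : ent G (Eq (Add t Zero) t).
Proof.
apply: ent_provable.
exact: (provable_inst t t t _ _ (provable_axiom ax_add0)).
Qed.

(** Reflexivity is not an axiom; it follows from [t + 0 = t], used twice, by the Euclidean form of
    transitivity. *)
Lemma ent_refl t : ent G (Eq t t).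
Proof. exact: ent_euclid (ent_add0 t) (ent_add0 t). Qed.

Lemma ent_sym t u : ent G (Eq t u) -> ent G (Eq u t).
Proof. by move=> tu; apply: ent_euclid tu (ent_refl t). Qed.

Lemma ent_trans u t v : ent G (Eq t u) -> ent G (Eq u v) -> ent G (Eq t v).
Proof. by move=> /ent_sym; apply: ent_euclid. Qed.

Lemma ent_succ t u : ent G (Eq t u) -> ent G (Eq (Succ t) (Succ u)).
Proof.
apply: ent_mp; apply: ent_provable.
exact: (provable_inst t u t _ _ (provable_axiom ax_eq_succ)).
Qed.

Lemma ent_succ_inj t u : ent G (Eq (Succ t) (Succ u)) -> ent G (Eq t u).
Proof.
apply: ent_mp; apply: ent_provable.
exact: (provable_inst t u t _ _ (provable_axiom ax_succ_inj)).
Qed.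

Lemma ent_succ_neq0 t A : ent G (Eq (Succ t) Zero) -> ent G A.
Proof.
move=> e; apply: ent_absurd e _; apply: ent_provable.
exact: (provable_inst t t t _ _ (provable_axiom ax_succ_neq0)).
Qed.

Lemma ent_addS t u : ent G (Eq (Add t (Succ u)) (Succ (Add t u))).
Proof.
apply: ent_provable.
exact: (provable_inst t u t _ _ (provable_axiom ax_addS)).
Qed.

Lemma ent_mul0 t : ent G (Eq (Mul t Zero) Zero).
Proof.
apply: ent_provable.
exact: (provable_inst t t t _ _ (provable_axiom ax_mul0)).
Qed.

Lemma ent_mulS t u : ent G (Eq (Mul t (Succ u)) (Add (Mul t u) t)).
Proof.
apply: ent_provable.
exact: (provable_inst t u t _ _ (provable_axiom ax_mulS)).
Qed.

(** Injectivity strips successors from both sides until exactly one side is [Zero]. *)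
Lemma ent_numeral_neq a b A :
  a != b -> ent G (Eq (numeral a) (numeral b)) -> ent G A.
Proof.
elim: a b => [|a IH] [|b] //= ab e.
- exact: ent_succ_neq0 (ent_sym e).
- exact: ent_succ_neq0 e.
- exact: IH ab (ent_succ_inj e).
Qed.

End Equality.

(** Among the operations only the successor has a congruence axiom. Here induction in PA runs on the
    right summand, with the equation inside the induction formula. *)
Lemma ent_addl G t u v : ent G (Eq t u) -> ent G (Eq (Add t v) (Add u v)).
Proof.
apply: ent_mp; apply: ent_provable.
have := @provable_inst t u v
  (Imp (Eq (Var 0) (Var 1)) (Eq (Add (Var 0) (Var 2)) (Add (Var 1) (Var 2)))).
apply=> //; apply: (@provable_ind 2) => /=.
  apply: (@ent_euclid [:: _] (Var 0)); first exact/ent_sym/ent_add0.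
  apply: (@ent_trans _ (Var 1)); [hyp|exact/ent_sym/ent_add0].
set H := [:: _]; set E := Eq (Var 0) (Var 1).
apply: (ent_trans (ent_addS (E :: H) _ _)).
apply: ent_trans (ent_sym (ent_addS (E :: H) _ _)).
by apply/ent_succ/(@ent_mp E); hyp.
Qed.

Lemma ent_add0l G t : ent G (Eq (Add Zero t) t).
Proof.
apply: ent_provable.
have := @provable_inst t t t (Eq (Add Zero (Var 0)) (Var 0)).
apply=> //; apply: (@provable_ind 0) => /=; first exact: (ent_add0 [::]).
by apply: (ent_trans (ent_addS _ _ _)); apply: ent_succ; hyp.
Qed.

Lemma ent_addSl G t u : ent G (Eq (Add (Succ t) u) (Succ (Add t u))).
Proof.
apply: ent_provable.
have := @provable_inst t u t
  (Eq (Add (Succ (Var 0)) (Var 1)) (Succ (Add (Var 0) (Var 1)))).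
apply=> //; apply: (@provable_ind 1) => /=.
  apply: (ent_trans (ent_add0 [::] _)).
  exact/ent_succ/ent_sym/ent_add0.
apply: (ent_trans (ent_addS _ _ _)); apply: ent_succ.
by apply: ent_trans (ent_sym (ent_addS _ _ _)); hyp.
Qed.

Lemma ent_addC G t u : ent G (Eq (Add t u) (Add u t)).
Proof.
apply: ent_provable.
have := @provable_inst t u t (Eq (Add (Var 0) (Var 1)) (Add (Var 1) (Var 0))).
apply=> //; apply: (@provable_ind 1) => /=.
  exact: ent_trans (ent_add0 [::] _) (ent_sym (ent_add0l _ _)).
apply: (ent_trans (ent_addS _ _ _)).
by apply: ent_trans (ent_sym (ent_addSl _ _ _)); apply: ent_succ; hyp.
Qed.

Lemma ent_add G t t' u u' :
  ent G (Eq t t') -> ent G (Eq u u') -> ent G (Eq (Add t u) (Add t' u')).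
Proof.
move=> tt' uu'; apply: (ent_trans (ent_addl u tt')).
apply: (ent_trans (ent_addC _ _ _)).
exact: ent_trans (ent_addl _ uu') (ent_addC _ _ _).
Qed.

Lemma ent_mull G t u v : ent G (Eq t u) -> ent G (Eq (Mul t v) (Mul u v)).
Proof.
apply: ent_mp; apply: ent_provable.
have := @provable_inst t u v
  (Imp (Eq (Var 0) (Var 1)) (Eq (Mul (Var 0) (Var 2)) (Mul (Var 1) (Var 2)))).
apply=> //; apply: (@provable_ind 2) => /=.
  exact: ent_trans (ent_mul0 [:: _] _) (ent_sym (ent_mul0 _ _)).
set H := [:: _]; set E := Eq (Var 0) (Var 1).
apply: (ent_trans (ent_mulS (E :: H) _ _)).
apply: ent_trans (ent_sym (ent_mulS (E :: H) _ _)).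
by apply: ent_add; [apply: (@ent_mp E); hyp|hyp].
Qed.

(* For a numeral on the right-hand side an external induction on [b] suffices,
   so that commutativity of multiplication is not needed. *)
Lemma ent_mulr_numeral G t u b :
  ent G (Eq u (numeral b)) -> ent G (Eq (Mul t u) (Mul t (numeral b))).
Proof.
elim: b G t u => [|b IH] G t u; apply: ent_mp; apply: ent_provable.
  (* In both cases of the external induction, induction in PA on the variable 1 serves as a case
     distinction between zero and successor. *)
  have := @provable_inst t u t
    (Imp (Eq (Var 1) Zero) (Eq (Mul (Var 0) (Var 1)) (Mul (Var 0) Zero))).
  apply=> //; apply: (@provable_ind 1) => /=; first exact: (ent_refl [:: _]).
  by apply: (@ent_succ_neq0 [:: _; _] (Var 1)); hyp.
have := @provable_inst t u t
  (Imp (Eq (Var 1) (numeral b.+1))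
       (Eq (Mul (Var 0) (Var 1)) (Mul (Var 0) (numeral b.+1)))).
rewrite /= !tinst_numeral; apply=> //.
  by have : tbound (numeral b) = 0; [elim: (b)|move->].
apply: (@provable_ind 1) => /=; rewrite !tsubst_id ?tfree_numeral //.
  by apply: (@ent_succ_neq0 [:: _] (numeral b)); apply: ent_sym; hyp.
set H := [:: _]; set E := Eq _ _.
apply: (ent_trans (ent_mulS (E :: H) _ _)).
apply: ent_trans (ent_sym (ent_mulS (E :: H) _ _)).
by apply: ent_addl; apply: IH; apply: ent_succ_inj; hyp.
Qed.

Lemma ent_add_numeral G a b :
  ent G (Eq (Add (numeral a) (numeral b)) (numeral (a + b))).
Proof.
elim: b => [|b IH]; first by rewrite addn0; apply: ent_add0.
by rewrite addnS; apply: (ent_trans (ent_addS _ _ _)); apply: ent_succ.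
Qed.

Lemma ent_mul_numeral G a b :
  ent G (Eq (Mul (numeral a) (numeral b)) (numeral (a * b))).
Proof.
elim: b => [|b IH]; first by rewrite muln0; apply: ent_mul0.
rewrite mulnSr; apply: (ent_trans (ent_mulS _ _ _)).
exact: ent_trans (ent_addl _ IH) (ent_add_numeral _ _ _).
Qed.

(** * Numerical evaluation of terms in PA *)

Fixpoint eval (v : nat -> nat) (t : term) : nat :=
  match t with
  | Var x => v x
  | Zero => 0
  | Succ t => (eval v t).+1
  | Add t u => eval v t + eval v u
  | Mul t u => eval v t * eval v u
  end.

(** The variables take their values from equations in the context, which avoids substituting whole
    tuples of numerals. *)
Lemma ent_eval G v t :
  (forall x, tfree x t -> ent G (Eq (Var x) (numeral (v x)))) ->
  ent G (Eq t (numeral (eval v t))).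
Proof.
elim: t => [x|_|t IH|t IHt u IHu|t IHt u IHu] /=.
- by apply; apply: eqxx.
- exact: ent_refl.
- by move=> h; apply: ent_succ; apply: IH.
- move=> h; apply: ent_trans (ent_add_numeral _ _ _).
  by apply: ent_add; [apply: IHt|apply: IHu] => x xt; apply: h; rewrite xt ?orbT.
- move=> h; apply: ent_trans (ent_mul_numeral _ _ _).
  (* Congruence in the right factor is available towards a numeral; in the left factor it is
     unrestricted. *)
  apply: (@ent_trans _ (Mul t (numeral (eval v u)))).
    by apply: ent_mulr_numeral; apply: IHu => x xt; apply: h; rewrite xt ?orbT.
  by apply: ent_mull; apply: IHt => x xt; apply: h; rewrite xt ?orbT.
Qed.

(** The term [t] witnesses [Ex x (x = t)], so the existential rule discharges the equation. *)
Lemma provable_eq_elim x t B :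
  ~~ tfree x t -> ~~ free x B -> provable (Imp (Eq (Var x) t) B) -> provable B.
Proof.
move=> xt xB /(provable_ex_imp xB) pB; apply: provable_mp pB _.
apply: (@ent_mp (subst x t (Eq (Var x) t)) [::]).
  exact/ent_axiom/ax_ex.
by rewrite /= eqxx tsubst_id //; apply: ent_refl.
Qed.

(** * Finite case distinctions on a sum *)

Lemma zero_or_succ x y :
  x != y -> provable (Or (Eq (Var x) Zero) (Ex y (Eq (Var x) (Succ (Var y))))).
Proof.
move=> xy; apply: (@provable_ind x); rewrite /= !eqxx (negPf xy) /=.
  by apply: (@ent_mp _ [::]) (ent_refl _ _); apply: ent_axiom (ax_orl _ _).
apply: (@ent_mp (Ex y (Eq (Succ (Var x)) (Succ (Var y))))).
  exact: ent_axiom (ax_orr _ _).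
apply: (@ent_mp (subst y (Var x) (Eq (Succ (Var x)) (Succ (Var y))))).
  exact/ent_axiom/ax_ex.
by rewrite /= eqxx eq_sym (negPf xy); apply: ent_refl.
Qed.

(** External induction on [n]: either [x] is zero and [b = n], or [x] is the successor of a fresh
    [y] and [y + b] equals the predecessor of [n]. *)
Lemma provable_sum_split n x b B :
  (forall i j, i + j = n ->
    provable (Imp (Eq b (numeral j)) (Imp (Eq (Var x) (numeral i)) B))) ->
  provable (Imp (Eq (Add (Var x) b) (numeral n)) B).
Proof.
have cases m z C : provable (Imp (Eq b (numeral m)) (Imp (Eq (Var z) Zero) C)) ->
    (forall y,
      ent [:: Eq (Succ (Add (Var y) b)) (numeral m); Eq (Var z) (Succ (Var y))] C) ->
    provable (Imp (Eq (Add (Var z) b) (numeral m)) C).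
  set S := Eq (Add _ _) _ => h0 hS.
  (* Fresh for [z], [b] and [C], as the elimination of [Ex y] demands. *)
  pose y := maxn z.+1 (maxn (tbound b) (fbound C)).
  have zy : z < y by rewrite leq_max leqnn.
  have yb : ~~ tfree y b by apply: tbound_tfree; rewrite !leq_max leqnn !orbT.
  have yC : ~~ free y C by apply: fbound_free; rewrite !leq_max leqnn !orbT.
  have /ent_orE orE := ent_provable [:: S] (zero_or_succ (negbT (ltn_eqF zy))).
  change (ent [:: S] C); apply: orE.
    apply: (@ent_mp (Eq (Var z) Zero)); last by hyp.
    apply: (@ent_mp (Eq b (numeral m))); first exact: ent_provable.
    apply: (@ent_euclid _ (Add (Var z) b)); last by hyp.
    by apply: ent_trans (ent_add0l _ b); apply: ent_addl; hyp.
  apply: ent_exE => //=; first by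
    rewrite orbF tfree_numeral orbF negb_or yb andbT gtn_eqF.
  set H := [:: _; _].
  apply: (@ent_cut (Eq (Succ (Add (Var y) b)) (numeral m))).
    apply: (@ent_euclid _ (Add (Var z) b)); last by hyp.
    by apply: ent_trans (ent_addSl _ _ b); apply: ent_addl; hyp.
  apply: ent_sub (hS y) => D; rewrite !inE => /orP[->//|->].
  by rewrite orbT.
elim: n x B => [|n IH] x B h.
  apply: cases => [|y]; first exact: (h 0 0).
  by apply: ent_succ_neq0; hyp.
apply: cases => [|y]; first exact: (h 0 n.+1).
apply: (@ent_mp (Eq (Var x) (Succ (Var y)))); last by hyp.
apply: (@ent_mp (Eq (Add (Var y) b) (numeral n))); last by apply: ent_succ_inj; hyp.
(* The induction hypothesis is used for the variable [y], with [x = S y -> B] as target formula. *)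
apply/ent_provable/IH => i j ij.
set K := [:: Eq (Var x) (Succ (Var y)); Eq (Var y) (numeral i); Eq b (numeral j)].
suff : ent K B by [].
apply: (@ent_mp (Eq (Var x) (numeral i.+1))).
  apply: (@ent_mp (Eq b (numeral j))); last by hyp.
  by apply/ent_provable/h; rewrite addSn ij.
by apply: (@ent_trans _ (Succ (Var y))); [hyp|apply: ent_succ; hyp].
Qed.

(** * Blocks of quantifiers *)

Definition tsum (xs : seq nat) : term := foldr (fun x => Add (Var x)) Zero xs.

Definition eqs (xs vs : seq nat) : seq formula :=
  [seq Eq (Var p.1) (numeral p.2) | p <- zip xs vs].

(** Bounded search inside PA: splitting off one summand at a time leaves only cases in which every
    variable equals a numeral. *)
Lemma provable_sum_bound xs n B :
  (forall vs, size vs = size xs -> ent (eqs xs vs) B) ->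
  provable (Imp (Eq (tsum xs) (numeral n)) B).
Proof.
elim: xs n B => [|x xs IH] n B h.
  by apply: (@ent_provable [:: _]); apply: (h [::]).
apply: provable_sum_split => i j _.
by apply: IH => vs svs; apply: (h (i :: vs)); rewrite /= svs.
Qed.

Lemma ent_eqs x xs vs :
  size vs = size xs -> x \in xs ->
  ent (eqs xs vs) (Eq (Var x) (numeral (nth 0 vs (index x xs)))).
Proof.
elim: xs vs => [//|y xs IH] [//|v vs] [svs].
rewrite inE eq_sym /=; case: eqP => [->|_] xxs; first by apply: ent_hyp; apply: mem_head.
exact/ent_wk/IH.
Qed.

(** The equations are discharged one by one; distinctness keeps each variable out of the equations
    for the others. *)
Lemma provable_eqs_elim xs vs B :
  uniq xs -> size vs = size xs -> {in xs, forall x, ~~ free x B} ->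
  ent (eqs xs vs) B -> provable B.
Proof.
elim: xs vs B => [|x xs IH] [|v vs] B //= /andP[xxs uxs] [svs] fB eB.
apply: (@provable_eq_elim x (numeral v)); first by rewrite tfree_numeral.
  by apply: fB; rewrite mem_head.
apply: IH eB => // z zxs; rewrite /= tfree_numeral orbF negb_or.
by rewrite fB ?inE ?zxs ?orbT // andbT; apply: contraNneq xxs => <-.
Qed.

Lemma free_exs x xs A : free x (exs xs A) = (x \notin xs) && free x A.
Proof. by elim: xs => //= y xs ->; rewrite inE negb_or andbA. Qed.

Lemma free_alls x xs A : free x (alls xs A) = (x \notin xs) && free x A.
Proof. by elim: xs => //= y xs ->; rewrite inE negb_or andbA. Qed.

Lemma ent_exs xs G A : ent G A -> ent G (exs xs A).
Proof. by elim: xs => //= x xs IH /IH; apply: ent_ex_var. Qed.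

Lemma ent_alls_elim xs G A : ent G (alls xs A) -> ent G A.
Proof. by elim: xs => //= x xs IH /ent_all_var. Qed.

Lemma provable_exs_imp xs A C :
  {in xs, forall x, ~~ free x C} -> provable (Imp A C) ->
  provable (Imp (exs xs A) C).
Proof.
elim: xs => //= x xs IH fC /IH pC; apply: provable_ex_imp.
  by apply: fC; rewrite mem_head.
by apply: pC => z zxs; apply: fC; rewrite inE zxs orbT.
Qed.

Lemma provable_imp_alls xs A C :
  {in xs, forall x, ~~ free x C} -> provable (Imp C A) ->
  provable (Imp C (alls xs A)).
Proof.
elim: xs => //= x xs IH fC /IH pC; apply: provable_all_imp.
  by apply: fC; rewrite mem_head.
by apply: pC => z zxs; apply: fC; rewrite inE zxs orbT.
Qed.

Lemma provable_alls xs A : provable A -> provable (alls xs A).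
Proof. by elim: xs => //= x xs IH /IH; apply: provable_all. Qed.

Lemma subst_alls x t xs A :
  x \notin xs -> subst x t (alls xs A) = alls xs (subst x t A).
Proof. by elim: xs => //= y xs IH; rewrite inE; case: eqP => //= _ /IH->. Qed.

Lemma tfree_tsum x xs : tfree x (tsum xs) = (x \in xs).
Proof. by elim: xs => //= y xs ->; rewrite inE. Qed.

(** * Representational formulas *)

Lemma eval_numeral v n : eval v (numeral n) = n.
Proof. by elim: n => //= n ->. Qed.

Lemma eval_tsubst v y c t :
  eval v (tsubst y (numeral c) t) = eval (fun x => if y == x then c else v x) t.
Proof.
elim: t => [x||t /= ->|t /= -> u ->|t /= -> u ->] //=.
by case: eqP => //; rewrite eval_numeral.
Qed.

Lemma eval_iterop v t e : eval v (iterop e Mul t (numeral 1)) = eval v t ^ e.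
Proof.
case: e => [//|e]; rewrite iteropS.
by elim: e => [|e IH] /=; rewrite ?expn1 // IH -expnS.
Qed.

Lemma eval_term_of n v (xs : n.-tuple nat) P :
  (eval v (term_of xs P))%:Z%R =
  ((mpoly_of P).@[fun i => (v (tnth xs i))%:Z])%R.
Proof.
elim: P => [i|c|P IHP Q IHQ|P IHP Q IHQ|P IHP e] /=.
- by rewrite mevalXU.
- by rewrite eval_numeral rmorph_nat natz.
- by rewrite mevalD -IHP -IHQ PoszD.
- by rewrite mevalM -IHP -IHQ PoszM.
- rewrite eval_iterop; elim: e => [|e IHe]; first by rewrite expr0 meval1.
  by rewrite expnS exprS mevalM -IHP -IHe PoszM.
Qed.

Lemma tfree_term_of n x (xs : n.-tuple nat) P :
  tfree x (term_of xs P) -> x \in xs.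
Proof.
elim: P => [i|c|P IHP Q IHQ|P IHP Q IHQ|P IHP [|e]] /=.
- by move/eqP->; apply: mem_tnth.
- by rewrite tfree_numeral.
- by case/orP.
- by case/orP.
- by [].
- by move=> h; apply: IHP; elim: e h => //= e IHe /orP[].
Qed.

Lemma tfree_tsubst_numeral x y c t :
  tfree x (tsubst y (numeral c) t) = (x != y) && tfree x t.
Proof.
elim: t => [z||t IH|t IHt u IHu|t IHt u IHu] /=.
- case: eqP => [->|/eqP yz] /=; first by rewrite tfree_numeral andNb.
  by case: eqP => [->|_]; rewrite ?andbF // eq_sym yz.
- by rewrite andbF.
- by [].
- by rewrite IHt IHu andb_orr.
- by rewrite IHt IHu andb_orr.
Qed.

Section Representational.
Variables (n : nat) (D : {mpoly int[n.+1]}) (y : nat) (xs : n.-tuple nat).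
Variables (d : formula) (c : nat).
Hypothesis rD : representational D [tuple of y :: xs] d.

Lemma representational_free x : free x (subst y (numeral c) d) -> x \in xs.
Proof.
case: rD => _ [DL [DR [_ ->]]] /=; rewrite !tfree_tsubst_numeral -andb_orr.
case/andP=> xy /orP[] /tfree_term_of; rewrite inE (negPf xy) //.
Qed.

(** From [xs = vs], PA evaluates both sides of the equation to numerals whose values are those of
    the two polynomials at [c, vs], and it decides equality of numerals. *)
Lemma representational_ent (vs : n.-tuple nat) :
  (is_root D [tuple of c :: vs] -> ent (eqs xs vs) (subst y (numeral c) d)) /\
  (~ is_root D [tuple of c :: vs] ->
   ent (eqs xs vs) (Neg (subst y (numeral c) d))).
Proof.
have fd := representational_free; case: rD fd => uxs [DL [DR [-> ->]]] /= fd.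
pose inst P := tsubst y (numeral c) (term_of [tuple of y :: xs] P).
rewrite -/(inst DL) -/(inst DR) in fd *; set tL := inst DL; set tR := inst DR.
pose v x := nth 0 vs (index x xs).
have evE P : ((eval v (inst P))%:Z =
    (mpoly_of P).@[fun i => (tnth [tuple of c :: vs] i)%:Z])%R.
  rewrite eval_tsubst eval_term_of; apply: meval_eq => i; congr (Posz _).
  have isz : i < size (y :: xs) by rewrite /= size_tuple.
  rewrite !(tnth_nth 0); have /= := index_uniq 0 isz uxs.
  (* As [y :: xs] has no repetition, the i-th variable sits at position i: position 0 carries [c],
     position j+1 carries entry j of [vs]. *)
  by case: (y =P _) => [_ <- //|_]; case: (nat_of_ord i) => //= j [ij]; rewrite /v ij.
have eL : ent (eqs xs vs) (Eq tL (numeral (eval v tL))).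
  by apply: ent_eval => x xt; apply: ent_eqs; rewrite ?size_tuple // fd ?xt.
have eR : ent (eqs xs vs) (Eq tR (numeral (eval v tR))).
  by apply: ent_eval => x xt; apply: ent_eqs; rewrite ?size_tuple // fd ?xt ?orbT.
have rootE : is_root (mpoly_of DL - mpoly_of DR)%R [tuple of c :: vs] <->
    eval v tL = eval v tR.
  have subE (a b : nat) : (a%:Z - b%:Z)%R = 0%R <-> a = b.
    by split=> [/eqP|->]; rewrite ?subrr // subr_eq0 => /eqP[].
  by rewrite /is_root mevalB -!evE; apply: subE.
split=> [/rootE e|nr]; first by apply: ent_trans eL _; rewrite e; apply: ent_sym.
(* Equality of distinct numerals entails anything, here the negation of [0 = 0]. *)
apply: (@ent_negI _ (Eq Zero Zero)); first exact: ent_refl.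
have ne : eval v tL != eval v tR by apply/eqP => /rootE.
apply: (ent_numeral_neq _ ne).
apply: ent_trans (ent_sym (ent_wk _ eL)) _.
by apply: ent_trans (ent_wk _ eR); apply: ent_hyp; apply: mem_head.
Qed.

(** The existential closure no longer has [xs] free, so the equations [xs = vs] can be
    discharged. *)
Lemma representational_exs (vs : n.-tuple nat) :
  is_root D [tuple of c :: vs] -> provable (exs xs (subst y (numeral c) d)).
Proof.
have [e _] := representational_ent vs => /e/(ent_exs xs).
apply: provable_eqs_elim; rewrite ?size_tuple //.
  by have [/andP[]] := rD.
by move=> x xxs; rewrite free_exs xxs.
Qed.

Lemma representational_omega :
  omega_consistent -> 
  (forall vs : n.-tuple nat, ~ is_root D [tuple of c :: vs]) ->
  ~ provable (exs xs (subst y (numeral c) d)).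
Proof.
set d' := subst _ _ _ => oc nr pd; apply: oc.
have fd x : free x d' -> x \in xs := @representational_free x.
(* An index above all of [xs]; hence [b] is not free in [d'] either. *)
pose b := tbound (tsum xs).
have bxs : b \notin xs by rewrite -tfree_tsum tbound_tfree.
exists b, (alls xs (Imp (Eq (tsum xs) (Var b)) (Neg d'))); split.
- move=> x; rewrite free_alls /= tfree_tsum.
  case: (boolP (x \in xs)) => [xxs|xxs] /=.
    by apply/esym/negbTE; apply: contraNneq bxs => <-.
  by rewrite [free x d'](contraNF (@fd x)) ?orbF.
- move=> i; rewrite subst_alls //= eqxx !tsubst_id ?tfree_tsum //.
  have -> : subst b (numeral i) d' = d'.
    have := fd b; rewrite /d'; case: rD => _ [DL [DR [_ ->]]] /= h.
    by rewrite !(@tsubst_id b) //; apply: contraNN bxs => bt; apply: h; rewrite bt ?orbT.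
  (* Once the sum is a numeral, only cases [xs = vs] remain, and PA refutes [d'] in each, as there
     is no root. *)
  apply: provable_alls; apply: provable_sum_bound => vs svs.
  have svs' : size vs == n by rewrite svs size_tuple.
  by have [_] := representational_ent (Tuple svs'); apply; apply: nr.
set A := alls xs _.
have fA x : x \in xs -> ~~ free x (Neg (All b A)).
  by move=> xxs; rewrite /= free_alls xxs andbF.
apply: provable_mp (provable_exs_imp fA _) pd.
(* The quantifiers on [xs] in [A] may capture the variables of [tsum xs], so [b] is not instantiated
   by it: [b = tsum xs] is added as a hypothesis, and [A] is used at [b] and [xs] themselves. *)
apply: (@provable_eq_elim b (tsum xs)); first by rewrite tfree_tsum.
  by rewrite /= eqxx orbF; apply: contraNN bxs => /fd.
pose E := Eq (Var b) (tsum xs).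
suff : ent [:: d'; E] (Neg (All b A)) by [].
apply: (@ent_negI _ d'); first by hyp.
apply: (@ent_mp (Eq (tsum xs) (Var b))); last by apply: ent_sym; hyp.
by apply/(@ent_alls_elim xs)/(@ent_all_var b); hyp.
Qed.

End Representational.

(** * Unprovability of the sentence and of its negation *)

(** An inconsistent PA proves everything, so any formula with exactly one free variable violates
    omega-consistency. *)
Lemma omega_consistent_consistent : omega_consistent -> consistent.
Proof.
move=> oc [A [pA pnA]]; have pB B : provable B by apply: (@ent_absurd A [::]).
by apply: oc; exists 0, (Eq (Var 0) Zero); split=> // y; rewrite /= orbF.
Qed.

Theorem theorem3 (k m : nat)
    (D_PE : {mpoly int[k.+2]}) (D_FC : {mpoly int[m.+1]})
    (HPE : forall (F : formula) (a : nat),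
       is_proof_code a F <->
       exists w : k.-tuple nat, is_root D_PE [tuple of code F :: a :: w])
    (HFC : forall a : nat,
       (exists w1 : m.-tuple nat, is_root D_FC [tuple of a :: w1]) <->
       is_formula_code a)
    (y x1 z : nat) (xw : k.-tuple nat) (xw1 : m.-tuple nat)
    (Hdistinct : uniq (x1 :: xw ++ xw1))
    (d_PE d_FC : formula)
    (HdPE : representational D_PE [tuple of y :: x1 :: xw] d_PE)
    (HdFC : representational D_FC [tuple of z :: xw1] d_FC)
    (G2 : formula) (HG2 : sentence G2)
    (Hdiag : provable
       (Iff G2
          (alls xw1
             (Imp (subst z (numeral (code G2)) d_FC)
                  (Neg (exs (x1 :: xw)
                          (subst y (numeral (code G2)) d_PE))))))) :
  (consistent -> ~ provable G2) /\
  (omega_consistent -> ~ provable (Neg G2)).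
Proof.
set dFC := subst z _ _ in Hdiag; set P := exs _ _ in Hdiag.
set B := alls _ _ in Hdiag.
have GB : provable (Imp G2 B).
  by apply: provable_mp Hdiag; apply: provable_axiom (ax_andl _ _).
have BG : provable (Imp B G2).
  by apply: provable_mp Hdiag; apply: provable_axiom (ax_andr _ _).
(* [P] is closed: [y] is replaced by a numeral and the other variables are quantified. *)
have fP x : ~~ free x P.
  rewrite free_exs; apply/negP => /andP[xn xd].
  by have := representational_free HdPE xd; rewrite (negPf xn).
have unprovable : consistent -> ~ provable G2.
  move=> con pG; apply: con; exists P; split.
    (* The code of a proof of [G2] is the value for [x1] in a solution, so PA proves [P]. *)
    have [s isp] := pG.
    have [|w rw] := (HPE G2 (proof_code s)).1; first by exists s.
    exact: (representational_exs HdPE (vs := [tuple of proof_code s :: w])) rw.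
  (* [G2] is a formula, so PA proves the existential closure of [dFC]; with [B] this yields
     [Neg P]. *)
  have [|w1 rw1] := (HFC (code G2)).2; first by exists G2.
  have fFC := representational_exs HdFC rw1; apply: provable_mp fFC.
  apply: provable_exs_imp; first by move=> x _; apply: fP.
  by apply: (@ent_alls_elim xw1 [::]); apply: provable_mp pG.
split=> // oc pnG; have con := omega_consistent_consistent oc.
apply: (representational_omega HdPE oc (c := code G2)).
  (* The first entry of a solution would be the code of a proof of [G2]. *)
  move=> vs rvs; apply: (unprovable con).
  have [s [_ pG]] : is_proof_code (thead vs) G2; last by exists s.
  by apply/HPE; exists [tuple of behead vs]; rewrite (tuple_eta vs) in rvs.
(* By contradiction: [Neg P] implies [dFC -> Neg P], hence [B], hence [G2], against [Neg G2]. *)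
apply: (@ent_negE P [::]).
apply: (@ent_negI _ G2 [::]); last exact: (ent_provable [:: _]).
apply: (@ent_mp B); first exact: ent_provable.
apply: provable_imp_alls; first by move=> x _; apply: fP.
by apply: (@ent_wk [:: Neg P] dFC); apply: provable_imp_refl.
Qed.
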